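(* Let $(\mathcal{C},\phi,\Delta)$ be a categorical Garside structure with Garside groupoid $\mathcal{G}$, let $m\ge1$, and let $\mathcal{C}_m$ be its $m$-divided category, with groupoid of fractions $\mathcal{G}_m$. The map $x\mapsto\Theta_m(x)$, $(x\xrightarrow{s}y)\mapsto(\Theta_m(x)\xrightarrow{\Theta_m(s)}\Theta_m(y))$, defined on objects $x$ and simple morphisms $s$ of $\mathcal{C}$, extends to a unique functor $\Theta_m:\mathcal{C}\to\mathcal{C}_m$, and the induced functor $\mathcal{G}\to\mathcal{G}_m$ is an equivalence of categories.
   Context: Conventions. Morphisms compose like paths: $x\xrightarrow{f}y\xrightarrow{g}z$ has composite $fg$. The image of an object or morphism under an automorphism $\phi$ is written $x^\phi$, $f^\phi$. In a category $\mathcal{C}$, $\mathcal{C}_{x\to}$ (resp. $\mathcal{C}_{\to x}$) is the set of morphisms with source (resp. target) $x$; $f\le g$ on $\mathcal{C}_{x\to}$ means $g=fh$ for some $h$; $g\ge h$ on $\mathcal{C}_{\to x}$ means $g=fh$ for some $f$. An atom is a non-identity morphism that is not a product of two non-identity morphisms. A categorical Garside structure is a triple $(\mathcal{C},\phi,\Delta)$ where $\mathcal{C}$ is a small category, $\phi$ is an automorphism of $\mathcal{C}$ and $\Delta$ is a natural transformation from the identity functor to $\phi$ (so $\Delta_x:x\to x^\phi$ and $f\Delta_y=\Delta_xf^\phi$ for $f:x\to y$), such that: $\mathcal{C}$ is homogeneous (there is a function $l$ from morphisms to $\mathbb{Z}_{\ge0}$ with $l(fg)=l(f)+l(g)$ and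 $l(f)=0$ iff $f$ is an identity); $\mathcal{C}$ is cancellative ($afb=agb$ implies $f=g$); every atom is simple, where $f:x\to y$ is simple if there is $\overline f:y\to x^\phi$ with $f\overline f=\Delta_x$ ($\overline f$ is then unique); for every object $x$, $(\mathcal{C}_{x\to},\le)$ and $(\mathcal{C}_{\to x},\ge)$ are lattices. The Garside groupoid $\mathcal{G}$ (groupoid of fractions) is obtained from $\mathcal{C}$ by formally inverting all morphisms. Divided category. Let $D_m$ be the set of sequences $f=(f_1,\dots,f_m)$ of composable $\mathcal{C}$-morphisms with $f_1\cdots f_m=\Delta_{x_1}$, $x_1$ the source of $f_1$ (each $f_i$ is then simple). Indices of such sequences of objects or morphisms are extended beyond $m$ by $a_{m+i}:=a_i^\phi$. Let $S_m$ be the oriented graph with vertex set $D_m$ in which an edge $f\to g$ is a sequence $s=(s_1,\dots,s_m)$ of simple morphisms of $\mathcal{C}$, $s_i$ going from the source of $f_i$ to the source of $g_i$, for which there are factorisations $f_i=s_is'_i$ with $g_i=s'_is_{i+1}$ for $i=1,\dots,m$ (with $s_{m+1}=s_1^\phi$). For edges $s:f\to g$, $t:g\to h$, the partial product $st:=(s_1t_1,\dots,s_mt_m)$ is defined exactly when each $s_it_i$ is simple and $(s_1t_1,\dots,s_mt_m)$ is an edge $f\to h$ of $S_m$. The category $\mathcal{C}_m$ is the free category on this germ: objects are the elements of $D_m$, morphisms are generated by the edges of $S_m$, subject to the relations that the formal composite of $s$ and $t$ equals $st$ whenever the partial product is defined, and that the edge $(1,\dots,1):f\to f$ is the identity of $f$.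 The groupoid $\mathcal{G}_m$ is obtained from $\mathcal{C}_m$ by formally inverting all morphisms. The map $\Theta_m$. For an object $x$ of $\mathcal{C}$, $\Theta_m(x):=(1_x,\dots,1_x,\Delta_x)\in D_m$. For a simple morphism $s:x\to y$ of $\mathcal{C}$, $\Theta_m(s)$ is the composite in $\mathcal{C}_m$ of $m$ edges of $S_m$ $$A_0\to A_1\to\cdots\to A_m,$$ where $A_0=\Theta_m(x)$, $A_m=\Theta_m(y)$, and for $1\le j\le m-1$, $A_j\in D_m$ is the sequence whose $(m-j)$-th term is $s$, whose $m$-th term is $\overline s$, and whose other terms are identities (of $x$ before position $m-j$, of $y$ after); for $1\le j\le m$ the $j$-th edge $A_{j-1}\to A_j$ has $(m+1-j)$-th component equal to $s$ and all other components identities. *)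

(* Defs.v *)
From mathcomp Require Import all_boot boolp.
From Stdlib Require Import Relation_Definitions.
From mathcomp Require Import zify.

Set Implicit Arguments.
Unset Strict Implicit.
Unset Printing Implicit Defensive.

Declare Scope cat_scope.
Delimit Scope cat_scope with cat.
Local Open Scope cat_scope.

Record category := Category {
  ob :> Type;
  hom : ob -> ob -> Type;
  idm : forall x, hom x x;
  comp : forall x y z, hom x y -> hom y z -> hom x z;
  comp1f : forall x y (f : hom x y), comp (idm x) f = f;
  compf1 : forall x y (f : hom x y), comp f (idm y) = f;
  compA : forall x y z t (f : hom x y) (g : hom y z) (h : hom z t),
    comp f (comp g h) = comp (comp f g) h }.

Arguments hom {c}.
Arguments idm {c}.
Arguments comp {c x y z}.
(** Diagrammatic order: [f ;; g] is [f] followed by [g]. *)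
Notation "f ;; g" := (comp f g) (at level 40, left associativity) : cat_scope.

(** [arrow C] is the set of all morphisms of [C]. Equality of [Arrow f] and
    [Arrow g] means that [f] and [g] have equal endpoints and are equal. *)
Record arrow (C : category) := Arrow { src : C; tgt : C; amor : hom src tgt }.
Arguments Arrow {C src tgt}.

Inductive is_comp (C : category) : arrow C -> arrow C -> arrow C -> Prop :=
| IsComp x y z (f : @hom C x y) (g : hom y z) :
    is_comp (Arrow f) (Arrow g) (Arrow (f ;; g)).

(** [seq_comp l a]: the terms of [l] are composable, with composite [a]. *)
Inductive seq_comp (C : category) : seq (arrow C) -> arrow C -> Prop :=
| SeqComp0 x : seq_comp [::] (Arrow (idm x))
| SeqCompS f l g h : seq_comp l g -> is_comp f g h -> seq_comp (f :: l) h.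

Definition is_identity (C : category) (a : arrow C) : Prop :=
  exists x, a = Arrow (idm x).

Definition atom (C : category) (a : arrow C) : Prop :=
  ~ is_identity a /\
  ~ exists b c, [/\ ~ is_identity b, ~ is_identity c & is_comp b c a].

Definition is_iso (C : category) (x y : C) (f : hom x y) : Prop :=
  exists g : hom y x, f ;; g = idm x /\ g ;; f = idm y.

Record functor (C D : category) := Functor {
  fob :> C -> D;
  fmap : forall x y : C, hom x y -> hom (fob x) (fob y);
  fmap1 : forall x : C, fmap (idm x) = idm (fob x);
  fmapM : forall (x y z : C) (f : hom x y) (g : hom y z),
    fmap (f ;; g) = fmap f ;; fmap g }.
Arguments fmap {C D} _ {x y}.

Definition fmap_arrow (C D : category) (F : functor C D) (a : arrow C) :
  arrow D := Arrow (fmap F (amor a)).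

Definition id_functor (C : category) : functor C C :=
  @Functor C C id (fun _ _ f => f) (fun _ => erefl) (fun _ _ _ _ _ => erefl).

Program Definition comp_functor (C D E : category)
    (F : functor C D) (G : functor D E) : functor C E :=
  @Functor C E (fun x => G (F x)) (fun _ _ f => fmap G (fmap F f)) _ _.
Next Obligation. by rewrite !fmap1. Qed.
Next Obligation. by rewrite !fmapM. Qed.

Definition is_automorphism (C : category) (F : functor C C) : Prop :=
  exists G : functor C C,
    comp_functor F G = id_functor C /\ comp_functor G F = id_functor C.

Definition natural (C D : category) (F G : functor C D)
    (eta : forall x : C, hom (F x) (G x)) : Prop :=
  forall (x y : C) (f : hom x y), fmap F f ;; eta y = eta x ;; fmap G f.

Definition naturally_isomorphic (C D : category) (F G : functor C D) : Prop :=
  exists eta : forall x : C, hom (F x) (G x),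
    natural eta /\ forall x, is_iso (eta x).

Definition is_equivalence (C D : category) (F : functor C D) : Prop :=
  exists G : functor D C,
    naturally_isomorphic (comp_functor F G) (id_functor C) /\
    naturally_isomorphic (comp_functor G F) (id_functor D).

(** The category presented by the graph [E] and the relations [R]: morphisms
    are classes of paths modulo the congruence generated by [R]. *)

Section Presentation.
Variables (V : Type) (E : V -> V -> Type).

Inductive gpath : V -> V -> Type :=
| PNil x : gpath x x
| PCons x y z : E x y -> gpath y z -> gpath x z.

Fixpoint pcat x y z (p : gpath x y) : gpath y z -> gpath x z :=
  match p with
  | PNil _ => fun q => q
  | PCons _ _ _ e p' => fun q => PCons e (pcat p' q)
  end.

Definition pedge x y (e : E x y) : gpath x y := PCons e (PNil y).

Lemma pcat0 x y (p : gpath x y) : pcat p (PNil y) = p.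
Proof. by elim: p => //= ? ? ? e p ->. Qed.

Lemma pcatA x y z t (p : gpath x y) (q : gpath y z) (r : gpath z t) :
  pcat p (pcat q r) = pcat (pcat p q) r.
Proof. by elim: p q => //= ? ? ? e p IH q; rewrite IH. Qed.

Variable R : forall x y, gpath x y -> gpath x y -> Prop.

Inductive pcong : forall x y, gpath x y -> gpath x y -> Prop :=
| PRel x y (p q : gpath x y) : R p q -> pcong p q
| PRefl x y (p : gpath x y) : pcong p p
| PSym x y (p q : gpath x y) : pcong p q -> pcong q p
| PTrans x y (p q r : gpath x y) : pcong p q -> pcong q r -> pcong p r
| PCat x y z (p p' : gpath x y) (q q' : gpath y z) :
    pcong p p' -> pcong q q' -> pcong (pcat p q) (pcat p' q').

Record pclass (x y : V) := PClass {
  pclass_set : gpath x y -> Prop;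
  pclassP : exists p, pclass_set = pcong p }.

Definition pclass_of x y (p : gpath x y) : pclass x y :=
  PClass (ex_intro _ p erefl).

Definition prepr x y (c : pclass x y) : gpath x y := projT1 (cid (pclassP c)).

Lemma piP x y (p q : gpath x y) : pclass_of p = pclass_of q <-> pcong p q.
Proof.
split=> [[->]|pq]; first exact: PRefl.
have e : pcong p = pcong q.
  apply: funext => r; apply: propext; split; apply: PTrans => //.
  exact: PSym.
rewrite /pclass_of; move: (ex_intro _ p _) (ex_intro _ q _) => /= wp wq.
by move: wp wq; rewrite e => wp wq; rewrite (Prop_irrelevance wp wq).
Qed.

Lemma preprK x y (c : pclass x y) : pclass_of (prepr c) = c.
Proof.
rewrite /prepr; case: (cid _) => p /=; case: c => S wS /= e.
rewrite /pclass_of; move: (ex_intro _ p _); rewrite -e => w.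
by rewrite (Prop_irrelevance w wS).
Qed.

Lemma repr_pi x y (p : gpath x y) : pcong (prepr (pclass_of p)) p.
Proof. by apply/piP; rewrite preprK. Qed.

Definition pcomp x y z (c : pclass x y) (d : pclass y z) : pclass x z :=
  pclass_of (pcat (prepr c) (prepr d)).

Lemma pcomp_pi x y z (p : gpath x y) (q : gpath y z) :
  pcomp (pclass_of p) (pclass_of q) = pclass_of (pcat p q).
Proof. by apply/piP; apply: PCat; apply: repr_pi. Qed.

Lemma pcomp1f x y (c : pclass x y) : pcomp (pclass_of (PNil x)) c = c.
Proof. by rewrite -(preprK c) pcomp_pi. Qed.

Lemma pcompf1 x y (c : pclass x y) : pcomp c (pclass_of (PNil y)) = c.
Proof. by rewrite -(preprK c) pcomp_pi pcat0. Qed.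

Lemma pcompA x y z t (c : pclass x y) (d : pclass y z) (e : pclass z t) :
  pcomp c (pcomp d e) = pcomp (pcomp c d) e.
Proof.
by rewrite -(preprK c) -(preprK d) -(preprK e) !pcomp_pi pcatA.
Qed.

Definition presented_category : category :=
  Category pcomp1f pcompf1 pcompA.

End Presentation.

Arguments PNil {V E}.
Arguments pclass_of {V E} R {x y}.

(** [inl f] stands for [f] and [inr f] for its formal inverse. *)

Definition zigzag (C : category) (x y : C) : Type := (hom x y + hom y x)%type.

Inductive fraction_rel (C : category) :
    forall x y, gpath (@zigzag C) x y -> gpath (@zigzag C) x y -> Prop :=
| FracId x : fraction_rel (pedge (inl (idm x) : zigzag x x)) (PNil x)
| FracComp x y z (f : @hom C x y) (g : hom y z) :
    fraction_rel
      (pcat (pedge (inl f : zigzag x y)) (pedge (inl g : zigzag y z)))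
      (pedge (inl (f ;; g) : zigzag x z))
| FracInvR x y (f : @hom C x y) :
    fraction_rel
      (pcat (pedge (inl f : zigzag x y)) (pedge (inr f : zigzag y x))) (PNil x)
| FracInvL x y (f : @hom C x y) :
    fraction_rel
      (pcat (pedge (inr f : zigzag y x)) (pedge (inl f : zigzag x y))) (PNil y).

Definition groupoid_of_fractions (C : category) : category :=
  presented_category (@fraction_rel C).

Program Definition to_fractions (C : category) :
    functor C (groupoid_of_fractions C) :=
  @Functor C (groupoid_of_fractions C) id
    (fun x y f => pclass_of (@fraction_rel C) (pedge (inl f : zigzag x y))) _ _.
Next Obligation. by apply/piP/PRel/FracId. Qed.
Next Obligation.
rewrite pcomp_pi.
by apply/piP/PSym/PRel; apply: FracComp.
Qed.

Section InducedFunctor.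
Variables (C D : category) (F : functor C D).

Definition zigzag_map x y (e : @zigzag C x y) : zigzag (F x) (F y) :=
  match e with inl f => inl (fmap F f) | inr f => inr (fmap F f) end.

Fixpoint path_map x y (p : gpath (@zigzag C) x y) :
    gpath (@zigzag D) (F x) (F y) :=
  match p with
  | PNil x => PNil (F x)
  | PCons _ _ _ e p' => PCons (zigzag_map e) (path_map p')
  end.

Lemma path_map_cat x y z (p : gpath (@zigzag C) x y)
    (q : gpath (@zigzag C) y z) :
  path_map (pcat p q) = pcat (path_map p) (path_map q).
Proof. by elim: p q => //= ? ? ? e p IH q; rewrite IH. Qed.

Lemma path_map_cong x y (p q : gpath (@zigzag C) x y) :
  pcong (@fraction_rel C) p q ->
  pcong (@fraction_rel D) (path_map p) (path_map q).
Proof.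
elim=> {x y p q} [x y p q|||x y p q r _ IH1 _ IH2|x y z p p' q q' _ IH1 _ IH2].
- case=> {x y p q} [x|x y z f g|x y f|x y f] /=; apply: PRel.
  + by rewrite fmap1; apply: FracId.
  + by rewrite fmapM; apply: FracComp.
  + exact: FracInvR.
  + exact: FracInvL.
- by move=> *; apply: PRefl.
- by move=> *; apply: PSym.
- exact: PTrans IH1 IH2.
- by rewrite !path_map_cat; apply: PCat.
Qed.

Definition fractions_map (x y : groupoid_of_fractions C) (c : hom x y) :
    @hom (groupoid_of_fractions D) (F x) (F y) :=
  pclass_of (@fraction_rel D) (path_map (prepr c)).

Lemma fractions_map_pi x y (p : gpath (@zigzag C) x y) :
  fractions_map (pclass_of (@fraction_rel C) p) = pclass_of (@fraction_rel D) (path_map p).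
Proof. by apply/piP/path_map_cong/repr_pi. Qed.

Program Definition induced_functor :
    functor (groupoid_of_fractions C) (groupoid_of_fractions D) :=
  @Functor (groupoid_of_fractions C) (groupoid_of_fractions D)
    F fractions_map _ _.
Next Obligation. by rewrite fractions_map_pi. Qed.
Next Obligation.
rewrite -(preprK f) -(preprK g) /= pcomp_pi.
by rewrite !fractions_map_pi pcomp_pi path_map_cat.
Qed.

Lemma induced_functorE x y (f : @hom C x y) :
  fmap induced_functor (fmap (to_fractions C) f) =
  fmap (to_fractions D) (fmap F f).
Proof. exact: fractions_map_pi. Qed.

End InducedFunctor.

Section GarsideAxioms.
Variable C : category.

Definition homogeneous : Prop :=
  exists l : forall x y : C, hom x y -> nat,
    (forall (x y z : C) (f : hom x y) (g : hom y z),
       l _ _ (f ;; g) = l _ _ f + l _ _ g) /\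
    (forall (x y : C) (f : hom x y), l _ _ f = 0 <-> is_identity (Arrow f)).

Definition cancellative : Prop :=
  forall (x y z t : C) (a : hom x y) (f g : hom y z) (b : hom z t),
    a ;; f ;; b = a ;; g ;; b -> f = g.

Definition is_lattice (T : Type) (le : relation T) : Prop :=
  [/\ order T le,
      forall a b, exists j, [/\ le a j, le b j &
        forall c, le a c -> le b c -> le j c]
    & forall a b, exists k, [/\ le k a, le k b &
        forall c, le c a -> le c b -> le c k]].

Definition hom_from (x : C) : Type := {y : C & hom x y}.
Definition hom_to (x : C) : Type := {y : C & hom y x}.

Definition le_from (x : C) (f g : hom_from x) : Prop :=
  exists h : hom (projT1 f) (projT1 g), projT2 g = projT2 f ;; h.

Definition ge_to (x : C) (g h : hom_to x) : Prop :=
  exists f : hom (projT1 g) (projT1 h), projT2 g = f ;; projT2 h.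

Variables (phi : functor C C) (Delta : forall x : C, hom x (phi x)).

Definition simple (x y : C) (f : hom x y) : Prop :=
  exists fbar : hom y (phi x), f ;; fbar = Delta x.

End GarsideAxioms.

Record garside := Garside {
  gcat :> category;
  gphi : functor gcat gcat;
  gDelta : forall x : gcat, hom x (gphi x);
  gphi_aut : is_automorphism gphi;
  gDelta_natural : @natural gcat gcat (id_functor gcat) gphi gDelta;
  ghomogeneous : homogeneous gcat;
  gcancel : cancellative gcat;
  gatom_simple : forall a : arrow gcat, atom a -> simple gDelta (amor a);
  glattice_from : forall x : gcat, is_lattice (@le_from gcat x);
  glattice_to : forall x : gcat,
    is_lattice (fun f g : hom_to x => ge_to g f) }.

(** Sequences of length [m] are indexed from [0]: the term written [a_i] with
    [1 <= i <= m] in the literature is [a (i - 1)]. *)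

Section Divided.
Variables (G : garside) (m : nat) (m_gt0 : 0 < m).
Local Notation phi := (gphi G).
Local Notation Delta := (@gDelta G).

Definition ord_first : 'I_m := Ordinal m_gt0.

(** Extension beyond [m] by [a_(m + i) = a_i ^ phi]. *)
Definition extend (a : 'I_m -> arrow G) (i : nat) : arrow G :=
  iter (i %/ m) (fmap_arrow phi) (a (Ordinal (ltn_pmod i m_gt0))).

Definition in_divided (f : 'I_m -> arrow G) : Prop :=
  seq_comp (codom f) (Arrow (Delta (src (f ord_first)))).

Record divided_ob := DividedOb {
  dseq :> 'I_m -> arrow G;
  dseqP : in_divided dseq }.

Definition is_divided_edge (f g : divided_ob) (s : 'I_m -> arrow G) : Prop :=
  forall i : 'I_m,
    [/\ simple Delta (amor (s i)), src (s i) = src (f i),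
        tgt (s i) = src (g i)
      & exists s' : arrow G,
          is_comp (s i) s' (f i) /\ is_comp s' (extend s i.+1) (g i)].

Record divided_edge (f g : divided_ob) := DividedEdge {
  eseq :> 'I_m -> arrow G;
  eseqP : is_divided_edge f g eseq }.

(** The partial product of [s] and [t] is defined exactly when their termwise
    composite is (the underlying sequence of) an edge [u]. *)
Inductive germ_rel : forall f g : divided_ob,
    gpath divided_edge f g -> gpath divided_edge f g -> Prop :=
| GermComp f g h (s : divided_edge f g) (t : divided_edge g h)
    (u : divided_edge f h) :
    (forall i, is_comp (s i) (t i) (u i)) ->
    germ_rel (pcat (pedge s) (pedge t)) (pedge u)
| GermId f (s : divided_edge f f) :
    (forall i, is_identity (s i)) -> germ_rel (pedge s) (PNil f).

Definition divided_category : category := presented_category germ_rel.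

Lemma extend_lt (h : nat -> arrow G) i :
  i < m -> extend (fun k : 'I_m => h k) i = h i.
Proof. by move=> lt_im; rewrite /extend /= divn_small // modn_small. Qed.

Lemma extend_m (h : nat -> arrow G) :
  extend (fun k : 'I_m => h k) m = fmap_arrow phi (h 0).
Proof. by rewrite /extend /= divnn m_gt0 modnn. Qed.

(* [q i] is the composite of the terms of index at least [i]. *)
Lemma seq_comp_suffix (h q : nat -> arrow G) (x : G) :
  q m = Arrow (idm x) ->
  (forall i, i < m -> is_comp (h i) (q i.+1) (q i)) ->
  seq_comp (codom (fun k : 'I_m => h k)) (q 0).
Proof.
move=> qm qS.
have -> : codom (fun k : 'I_m => h k) = [seq h i | i <- iota 0 m].
  by rewrite codomE -val_enum_ord -map_comp.
have gen n k : k + n = m -> seq_comp [seq h i | i <- iota k n] (q k).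
  elim: n k => [|n IH] k /= kn; first by rewrite -[k]addn0 kn qm; constructor.
  apply: SeqCompS (IH k.+1 _) (qS k _); lia.
exact: gen.
Qed.

Lemma IsComp' (x y z : G) (f : hom x y) (g : hom y z) h :
  f ;; g = h -> is_comp (Arrow f) (Arrow g) (Arrow h).
Proof. by move <-; constructor. Qed.

Definition theta_seq (x : G) (i : 'I_m) : arrow G :=
  if i.+1 == m then Arrow (Delta x) else Arrow (idm x).

Lemma theta_seqP x : in_divided (theta_seq x).
Proof.
rewrite /in_divided.
have -> : src (theta_seq x ord_first) = x by rewrite /theta_seq; case: ifP.
pose h i : arrow G := if i.+1 == m then Arrow (Delta x) else Arrow (idm x).
pose q i : arrow G := if i == m then Arrow (idm (phi x)) else Arrow (Delta x).
have -> : Arrow (Delta x) = q 0 by rewrite /q; case: eqP => //; lia.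
apply: (@seq_comp_suffix h q (phi x)); first by rewrite /q eqxx.
move=> i lt_im; rewrite /h /q (ltn_eqF lt_im).
by case: ifP => _; apply: IsComp'; rewrite ?comp1f ?compf1.
Qed.

Definition theta_ob (x : G) : divided_ob := DividedOb (theta_seqP x).

Section ThetaMor.
Variables (x y : G) (s : hom x y) (sbar : hom y (phi x)).
Hypothesis s_sbar : s ;; sbar = Delta x.

Lemma sbar_phi : sbar ;; fmap phi s = Delta y.
Proof.
apply: (@gcancel G _ _ _ _ s _ _ (idm _)); rewrite !compf1 compA s_sbar.
exact/esym/(gDelta_natural s).
Qed.

(* The sequence [A_j] (0 <= j <= m) and the components of [A_j -> A_(j+1)]. *)
Definition theta_step_seq (j i : nat) : arrow G :=
  if i.+1 == m then
    if j == 0 then Arrow (Delta x)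
    else if j == m then Arrow (Delta y) else Arrow sbar
  else if i.+1 < m - j then Arrow (idm x)
  else if i.+1 == m - j then Arrow s else Arrow (idm y).

Definition theta_edge_seq (j i : nat) : arrow G :=
  if i.+1 < m - j then Arrow (idm x)
  else if i.+1 == m - j then Arrow s else Arrow (idm y).

Lemma theta_step_seq0 (i : 'I_m) : theta_step_seq 0 i = theta_seq x i.
Proof.
have := ltn_ord i; rewrite /theta_step_seq /theta_seq.
by do ![case: ifP] => * //; lia.
Qed.

Lemma theta_step_seqm (i : 'I_m) : theta_step_seq m i = theta_seq y i.
Proof.
have := ltn_ord i; rewrite /theta_step_seq /theta_seq.
by do ![case: ifP] => * //; lia.
Qed.

Lemma theta_stepP j : j <= m ->
  in_divided (fun i : 'I_m => theta_step_seq j i).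
Proof.
move=> le_jm.
have [->|j_neq0] := eqVneq j 0.
  have -> : (fun i : 'I_m => theta_step_seq 0 i) = theta_seq x.
    by apply: funext => i; rewrite theta_step_seq0.
  exact: theta_seqP.
have [->|j_neqm] := eqVneq j m.
  have -> : (fun i : 'I_m => theta_step_seq m i) = theta_seq y.
    by apply: funext => i; rewrite theta_step_seqm.
  exact: theta_seqP.
rewrite /in_divided.
have -> : src (theta_step_seq j ord_first) = x.
  by rewrite /theta_step_seq /=; do ![case: ifP] => * //; lia.
pose q i : arrow G := if i == m then Arrow (idm (phi x))
  else if m - j <= i then Arrow sbar else Arrow (Delta x).
have -> : Arrow (Delta x) = q 0 by rewrite /q; do ![case: ifP] => * //; lia.
apply: (@seq_comp_suffix (theta_step_seq j) q (phi x)).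
  by rewrite /q eqxx.
move=> i lt_im; rewrite /theta_step_seq /q.
do ![case: ifP] => * //; try lia; apply: IsComp';
  by rewrite ?comp1f ?compf1 ?s_sbar.
Qed.

Definition theta_step j (le_jm : j <= m) : divided_ob :=
  DividedOb (theta_stepP le_jm).

Lemma theta_step0 (le_0m : 0 <= m) : theta_step le_0m = theta_ob x.
Proof.
rewrite /theta_step /theta_ob; move: (theta_stepP _).
have -> : (fun i : 'I_m => theta_step_seq 0 i) = theta_seq x.
  by apply: funext => i; rewrite theta_step_seq0.
by move=> p; rewrite (Prop_irrelevance p (theta_seqP x)).
Qed.

Lemma theta_stepm (le_mm : m <= m) : theta_step le_mm = theta_ob y.
Proof.
rewrite /theta_step /theta_ob; move: (theta_stepP _).
have -> : (fun i : 'I_m => theta_step_seq m i) = theta_seq y.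
  by apply: funext => i; rewrite theta_step_seqm.
by move=> p; rewrite (Prop_irrelevance p (theta_seqP y)).
Qed.

Lemma theta_edgeP j (lt_jm : j < m) :
  is_divided_edge (theta_step (ltnW lt_jm)) (theta_step lt_jm)
    (fun i : 'I_m => theta_edge_seq j i).
Proof.
move=> [i lt_im] /=; split.
- rewrite /theta_edge_seq; do ![case: ifP] => _ /=.
  + by exists (Delta x); rewrite comp1f.
  + by exists sbar.
  + by exists (Delta y); rewrite comp1f.
- by rewrite /theta_edge_seq /theta_step_seq; do ![case: ifP] => * //; lia.
- by rewrite /theta_edge_seq /theta_step_seq; do ![case: ifP] => * //; lia.
have [ltSm|geSm] := ltnP i.+1 m.
  rewrite (extend_lt (theta_edge_seq j)) //.
  exists (if i.+1 < m - j then Arrow (idm x) else Arrow (idm y)).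
  rewrite /theta_edge_seq /theta_step_seq.
  by split; do ![case: ifP] => * //; try lia; apply: IsComp';
    rewrite ?comp1f ?compf1.
have {geSm} eSm : i.+1 = m by lia.
rewrite [X in extend _ X]eSm extend_m; exists (Arrow sbar).
rewrite /theta_edge_seq /theta_step_seq /fmap_arrow.
split; do ![case: ifP] => * //=; try lia; apply: IsComp';
  by rewrite ?comp1f ?fmap1 ?compf1 ?sbar_phi.
Qed.

Definition theta_edge j (lt_jm : j < m) :
    divided_edge (theta_step (ltnW lt_jm)) (theta_step lt_jm) :=
  DividedEdge (theta_edgeP lt_jm).

Fixpoint theta_path j : forall le_jm : j <= m,
    gpath divided_edge (theta_step (leq0n m)) (theta_step le_jm) :=
  match j with
  | 0 => fun le_0m =>
      ecast h (gpath divided_edge (theta_step (leq0n m)) (theta_step h))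
        (bool_irrelevance (leq0n m) le_0m) (PNil _)
  | j'.+1 => fun lt_jm =>
      pcat (theta_path (ltnW lt_jm)) (pedge (theta_edge lt_jm))
  end.

(** The class of [A_0 -> A_1 -> ... -> A_m]; by [theta_step0] and
    [theta_stepm] its endpoints are [theta_ob x] and [theta_ob y]. *)
Definition theta_mor :
    @hom divided_category (theta_step (leq0n m)) (theta_step (leqnn m)) :=
  pclass_of germ_rel (theta_path (leqnn m)).

End ThetaMor.

Definition extends_theta (F : functor G divided_category) : Prop :=
  (forall x : G, F x = theta_ob x) /\
  (forall (x y : G) (s : hom x y) (sbar : hom y (phi x))
     (s_sbar : s ;; sbar = Delta x),
     Arrow (fmap F s) = Arrow (theta_mor s_sbar)).

End Divided.

(* Main.v *)
Require Import Defs.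
From mathcomp Require Import all_boot.
From mathcomp Require Import boolp zify.

Set Implicit Arguments.
Unset Strict Implicit.
Unset Printing Implicit Defensive.

Local Open Scope cat_scope.

(** The point of the proof is an explicit description of the divided category.
    An object is a factorisation [f_1 ... f_m] of [Delta], that is, a diagram
    [x_1 -> x_2 -> ... -> x_m -> x_1^phi], and every morphism [f -> g] has
    components [a_i : x_i -> y_i], the composites of the components of its
    edges.  These satisfy [f_i a_(i+1) = a_i g_i] with [a_(m+1) = a_1^phi];
    such a family is called a transformation below.  Conversely, morphisms
    [f -> g] are the same thing as transformations:

    - fullness ([trans_path]): the componentwise gcds of [a_i] and [f_i] form an
      edge, which can be split off on the left.  It is not the identity unless
      all [a_i] are identities ([coprime_trans]): a simple divisor of [a_1] not
      dividing [f_1] yields, through its lcm with [f_1], a nontrivial divisor of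
      [a_2], and so on; the divisor of [a_k] obtained in this way also divides
      [f_k ... f_m], which becomes trivial.
      So [a] decomposes into edges by induction on its total length.
    - faithfulness ([pcomps_inj]): by the germ relations every path with
      components [a] can be rewritten to begin with that greatest edge, and one
      cancels it.

    Once this is known, [Theta] is the functor sending [s] to the constant
    family [(s, ..., s)]; it has the prescribed values because the path
    [A_0 -> ... -> A_m] has all its composites equal to [s], and it is unique
    because the simple morphisms generate ([simple_ind]).

    Taking the first component is a functor back with [first_functor (Theta x)]
    equal to [x].  The products [f_1 ... f_(i-1)] are the components of a
    transformation [gather f] from [Theta x_1] to [f].  It is already natural in
    the divided category, and becomes invertible, like every morphism, in the
    groupoid of fractions. *)

(** * Composing arrows whose endpoints agree propositionally *)

(** Terms of an object of the divided category are arrows whose endpoints match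
    only up to propositional equality, so composition is made a total operation
    on arrows.  The value [a] on non-composable pairs makes [src_acomp] hold
    without a side condition. *)
Definition acomp (C : category) (a b : arrow C) : arrow C :=
  match pselect (tgt a = src b) with
  | left e => Arrow (amor a ;; ecast z (hom z (tgt b)) (esym e) (amor b))
  | right _ => a
  end.

Arguments acomp : simpl never.
Notation "a ** b" := (acomp a b) (at level 40, left associativity).

Definition aid (C : category) (x : C) : arrow C := Arrow (idm x).

Section ArrowCalculus.
Variable C : category.
Implicit Types a b c d : arrow C.

Definition hom_of a x y (ex : src a = x) (ey : tgt a = y) : hom x y :=
  ecast z (hom z y) ex (ecast z (hom (src a) z) ey (amor a)).

Lemma hom_ofK a x y (ex : src a = x) (ey : tgt a = y) :
  Arrow (hom_of ex ey) = a.
Proof. by rewrite /hom_of; subst x y; case: a. Qed.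

Lemma acompE (x y z : C) (f : hom x y) (g : hom y z) :
  Arrow f ** Arrow g = Arrow (f ;; g).
Proof.
by rewrite /acomp; case: pselect => //= e; rewrite (Prop_irrelevance e erefl).
Qed.

Lemma arrow_inj (x y : C) (f g : hom x y) : Arrow f = Arrow g -> f = g.
Proof.
move=> e; have hom_ofE (h : hom x y) ex ey : @hom_of (Arrow h) x y ex ey = h.
  by rewrite /hom_of (Prop_irrelevance ex erefl) (Prop_irrelevance ey erefl).
suff H a ex ey : Arrow g = a -> @hom_of a x y ex ey = g.
  by rewrite -(hom_ofE f erefl erefl); apply: H.
by move=> ea; subst a; apply: hom_ofE.
Qed.

Lemma src_acomp a b : src (a ** b) = src a.
Proof. by rewrite /acomp; case: pselect. Qed.

Lemma tgt_acomp a b : tgt a = src b -> tgt (a ** b) = tgt b.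
Proof. by rewrite /acomp; case: pselect. Qed.

Lemma acompA a b c :
  tgt a = src b -> tgt b = src c -> a ** (b ** c) = a ** b ** c.
Proof.
case: a b c => [x y f] [y' z g] [z' t h] /= ey ez; subst y' z'.
by rewrite !acompE Defs.compA.
Qed.

Lemma acomp1f a x : x = src a -> aid x ** a = a.
Proof. by case: a => [x' y f] /= ->; rewrite acompE Defs.comp1f. Qed.

Lemma acompf1 a x : tgt a = x -> a ** aid x = a.
Proof. by case: a => [x' y f] /= <-; rewrite acompE Defs.compf1. Qed.

Lemma is_compP a b c : is_comp a b c <-> tgt a = src b /\ a ** b = c.
Proof.
split=> [[x y z f g]|[]]; first by rewrite acompE.
case: a b => [x y f] [y' z g] /= e; subst y'; rewrite acompE => <-.
by constructor.
Qed.

Lemma is_identityP a : is_identity a <-> a = aid (src a).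
Proof. by split=> [[x ->]|->]; last exists (src a). Qed.

Lemma tgt_identity a : is_identity a -> tgt a = src a.
Proof. by case=> x ->. Qed.

Definition adiv a b := exists2 c, tgt a = src c & a ** c = b.

Lemma adiv_src a b : adiv a b -> src a = src b.
Proof. by case=> c _ <-; rewrite src_acomp. Qed.

Lemma adiv_refl a : adiv a a.
Proof. by exists (aid (tgt a)); rewrite ?acompf1. Qed.

Lemma adiv_mulr a b c : tgt b = src c -> adiv a b -> adiv a (b ** c).
Proof.
move=> ebc [d ead eb]; have edc: tgt d = src c by rewrite -ebc -eb tgt_acomp.
by exists (d ** c); rewrite ?src_acomp // acompA // eb.
Qed.

Lemma adiv_trans a b c : adiv a b -> adiv b c -> adiv a c.
Proof. by move=> ab [d e <-]; apply: adiv_mulr. Qed.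

End ArrowCalculus.

Lemma fmap_acomp (C D : category) (F : functor C D) (a b : arrow C) :
  tgt a = src b ->
  fmap_arrow F (a ** b) = fmap_arrow F a ** fmap_arrow F b.
Proof.
case: a b => [x y f] [y' z g] /= e; subst y'.
by rewrite acompE /fmap_arrow /= acompE fmapM.
Qed.

Lemma fmap_aid (C D : category) (F : functor C D) x :
  fmap_arrow F (aid x) = aid (F x).
Proof. by rewrite /fmap_arrow /= fmap1. Qed.

Lemma fmap_identity (C D : category) (F : functor C D) (a : arrow C) :
  is_identity a -> is_identity (fmap_arrow F a).
Proof. by case=> x ->; exists (F x); exact: fmap_aid. Qed.

Lemma functor_ext (C D : category) (F H : functor C D) :
  (forall x, F x = H x) ->
  (forall x y (f : hom x y), Arrow (fmap F f) = Arrow (fmap H f)) -> F = H.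
Proof.
case: F H => [Fo Fm F1 FM] [Ho Hm H1 HM] /= /funext eo; subst Ho => em.
have e: Fm = Hm.
  apply: functional_extensionality_dep => x.
  apply: functional_extensionality_dep => y.
  by apply: funext => f; apply: arrow_inj.
subst Hm.
by rewrite (Prop_irrelevance F1 H1) (Prop_irrelevance FM HM).
Qed.

(** * Divisibility in a Garside category *)

Section GarsideArrows.
Variable G : garside.
Implicit Types a b c d : arrow G.
Local Notation phi := (gphi G).
Local Notation "a ^phi" := (fmap_arrow phi a) (at level 2, format "a ^phi").

Definition aDelta (x : G) : arrow G := Arrow (gDelta x).

Lemma acomp_cancell a b c :
  tgt a = src b -> tgt a = src c -> a ** b = a ** c -> b = c.
Proof.
move=> eb ec e.
have et : tgt b = tgt c by rewrite -(tgt_acomp eb) e tgt_acomp.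
case: a b c eb ec et e => [x y f] [y1 z1 g] [y2 z2 h] /= ??? e; subst.
congr Arrow; apply: (@gcancel G _ _ _ _ f _ _ (idm _)); rewrite !compf1.
by apply: arrow_inj; rewrite -!acompE.
Qed.

Lemma adiv_cancel a b c : tgt a = src b -> tgt a = src c ->
  adiv (a ** b) (a ** c) -> adiv b c.
Proof.
move=> eb ec [d]; rewrite tgt_acomp // => ed; rewrite -acompA //.
by move=> e; exists d => //; apply: acomp_cancell e => //; rewrite src_acomp.
Qed.

Lemma aDelta_natural a : a ** aDelta (tgt a) = aDelta (src a) ** a^phi.
Proof.
case: a => [x y f]; rewrite /aDelta /fmap_arrow /= !acompE.
by congr Arrow; have := gDelta_natural f.
Qed.

Definition asimple a := adiv a (aDelta (src a)).

Lemma simpleP a : simple (@gDelta G) (amor a) <-> asimple a.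
Proof.
case: a => [x y f] /=; split=> [[h e]|[[y' z h] /= e]].
  by exists (Arrow h) => //; rewrite acompE e.
subst y'; rewrite acompE => e.
have ez : z = phi x by have /(congr1 (@tgt _)) := e.
by subst z; exists h; apply: arrow_inj.
Qed.

Lemma alength : exists l : arrow G -> nat,
  (forall a b, tgt a = src b -> l (a ** b) = l a + l b) /\
  (forall a, l a = 0 <-> is_identity a).
Proof.
have [l [lM l0]] := @ghomogeneous G.
exists (fun a => l _ _ (amor a)); split=> [|[x y f]]; last exact: l0.
by move=> [x y f] [y' z g] /= e; subst y'; rewrite acompE lM.
Qed.

Definition alen : arrow G -> nat := projT1 (cid alength).

Lemma alenM a b : tgt a = src b -> alen (a ** b) = alen a + alen b.
Proof. by rewrite /alen; case: cid => l [? ?] /=; eauto. Qed.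

Lemma alen0 a : alen a = 0 <-> is_identity a.
Proof. by rewrite /alen; case: cid => l [? ?] /=; eauto. Qed.

Lemma alen_aid x : alen (aid x) = 0.
Proof. by apply/alen0; exists x. Qed.

Lemma alen_adiv a b : adiv a b -> alen a <= alen b.
Proof. by case=> c e <-; rewrite alenM // leq_addr. Qed.

Lemma asimple_adiv a b : adiv a b -> asimple b -> asimple a.
Proof. by move=> ab; rewrite /asimple (adiv_src ab); apply: adiv_trans. Qed.

(** If [a ** b ** c] is [Delta] then [b ** c ** a^phi] is [Delta] too, by
    naturality of [Delta] and cancellation of [a]. *)
Lemma asimple_suffix a b : tgt a = src b -> asimple (a ** b) -> asimple b.
Proof.
move=> ab [c]; rewrite tgt_acomp // src_acomp => bc; rewrite -acompA // => e.
have abc : tgt a = src (b ** c) by rewrite src_acomp.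
have tc : tgt c = src a^phi.
  by rewrite -(tgt_acomp bc) -(tgt_acomp abc) e.
exists (c ** a^phi); first by rewrite src_acomp.
apply: (@acomp_cancell a); rewrite ?src_acomp // acompA ?src_acomp //.
by rewrite acompA ?tgt_acomp // -(@acompA _ a b c) // e -aDelta_natural ab.
Qed.

(** Atoms are simple, and homogeneity makes the decomposition of an arrow into
    shorter factors well founded. *)
Lemma simple_ind (P : arrow G -> Prop) :
  (forall x, P (aid x)) -> (forall a, asimple a -> P a) ->
  (forall a b, tgt a = src b -> P a -> P b -> P (a ** b)) -> forall a, P a.
Proof.
move=> P1 Ps PM a; have [n] := ubnP (alen a); elim: n a => // n IH a lta.
have [[x ->]|na1] := pselect (is_identity a); first exact: P1.
have [ata|nata] := pselect (atom a).
  exact/Ps/simpleP/gatom_simple.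
have [b [c [nb nc /is_compP[ebc ea]]]] : exists b c,
    [/\ ~ is_identity b, ~ is_identity c & is_comp b c a].
  by apply: contrapT => nex; apply: nata.
have ? : alen b <> 0 by move/alen0.
have ? : alen c <> 0 by move/alen0.
by rewrite -ea; move: lta; rewrite -ea alenM // => lta; apply: PM => //;
  apply: IH; lia.
Qed.

Lemma simple_prefix a : ~ is_identity a ->
  exists b, [/\ ~ is_identity b, asimple b & adiv b a].
Proof.
elim/simple_ind: a => [x|a sa na|a b ab IHa IHb nab].
- by case; exists x.
- by exists a; split=> //; apply: adiv_refl.
have [[x ea]|/IHa[c [nc sc ca]]] := pselect (is_identity a).
  by move: ab nab; rewrite ea /= => ab; rewrite acomp1f.
by exists c; split=> //; apply: adiv_mulr.
Qed.

(** The next two lemmas are the lattice axiom for [hom_from x], read in terms of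
    arrows with a common source. *)
Lemma agcd_ex a b : src a = src b -> exists c, [/\ adiv c a, adiv c b &
  forall d, adiv d a -> adiv d b -> adiv d c].
Proof.
case: a b => [x y f] [x' z g] /= e; subst x'.
have [_ _ meet] := glattice_from x.
have [[t k] [[u /= eu] [v /= ev] kmax]] := meet (existT _ y f) (existT _ z g).
exists (Arrow k); split.
- by exists (Arrow u); rewrite // acompE eu.
- by exists (Arrow v); rewrite // acompE ev.
move=> [x' w h] [[w1 y1 p] /= e1 +] [[w2 y2 q] /= e2]; subst w1 w2.
rewrite !acompE => ep eq.
have ?: x' = x by have /(congr1 (@src _)) := ep.
have ?: y1 = y by have /(congr1 (@tgt _)) := ep.
have ?: y2 = z by have /(congr1 (@tgt _)) := eq.
subst x' y1 y2.
have [||r /= er] := kmax (existT _ w h).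
- by exists p; apply/esym; apply: arrow_inj.
- by exists q; apply/esym; apply: arrow_inj.
by exists (Arrow r); rewrite // acompE er.
Qed.

Lemma alcm_ex a b : src a = src b -> exists c, [/\ adiv a c, adiv b c &
  forall d, adiv a d -> adiv b d -> adiv c d].
Proof.
case: a b => [x y f] [x' z g] /= e; subst x'.
have [_ join _] := glattice_from x.
have [[t k] [[u /= eu] [v /= ev] kmin]] := join (existT _ y f) (existT _ z g).
exists (Arrow k); split.
- by exists (Arrow u); rewrite // acompE eu.
- by exists (Arrow v); rewrite // acompE ev.
move=> _ [[y1 w1 p] /= e1 <-] [[y2 w2 q] /= e2]; subst y1 y2.
rewrite !acompE => e.
have ?: w2 = w1 by have /(congr1 (@tgt _)) := e.
subst w2; have [||r /= er] := kmin (existT _ w1 (f ;; p)).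
- by exists p.
- by exists q; apply/esym; apply: arrow_inj.
by exists (Arrow r); rewrite // acompE er.
Qed.

End GarsideArrows.


(** * Sequences extended beyond their length *)

Section DividedMorphisms.
Variables (G : garside) (m : nat) (m_gt0 : 0 < m).
Implicit Types (f g h : divided_ob G m_gt0) (a b u : 'I_m -> arrow G).
Local Notation phi := (gphi G).
Local Notation "a ^phi" := (fmap_arrow phi a) (at level 2, format "a ^phi").
Local Notation "a .[ k ]" := (extend m_gt0 a k).
Local Notation i0 := (ord_first m_gt0).
Local Notation path := (gpath (divided_edge (m_gt0 := m_gt0))).
Local Notation Cm := (divided_category G m_gt0).

Lemma extend_ord a (i : 'I_m) : a.[i] = a i.
Proof.
rewrite /extend divn_small //=; congr a; apply: val_inj.
by rewrite /= modn_small.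
Qed.

Lemma extend_m0 a : a.[m] = (a i0)^phi.
Proof.
rewrite /extend divnn m_gt0 /=; congr fmap_arrow; congr a; apply: val_inj.
by rewrite /= modnn.
Qed.

Lemma extend_0 a : a.[0] = a i0.
Proof. by rewrite -[RHS]extend_ord. Qed.

Lemma extend_ind (P : arrow G -> arrow G -> arrow G -> Prop) a b u :
  (forall x y z, P x y z -> P x^phi y^phi z^phi) ->
  (forall i, P (a i) (b i) (u i)) -> forall k, P a.[k] b.[k] u.[k].
Proof. by move=> Pphi P0 k; rewrite /extend; elim: (k %/ m) => //= n; auto. Qed.

Lemma extend_src a b k : (forall i, src (a i) = src (b i)) ->
  src a.[k] = src b.[k].
Proof.
move=> e; apply: (@extend_ind (fun x y _ => src x = src y) a b a) => //.
by move=> x y _ /= ->.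
Qed.

Lemma extend_tgt a b k : (forall i, tgt (a i) = src (b i)) ->
  tgt a.[k] = src b.[k].
Proof.
move=> e; apply: (@extend_ind (fun x y _ => tgt x = src y) a b a) => //.
by move=> x y _ /= ->.
Qed.

Lemma extend_acomp a b k : (forall i, tgt (a i) = src (b i)) ->
  (fun i => a i ** b i).[k] = a.[k] ** b.[k].
Proof.
move=> e; set u := fun i => _.
suff []: tgt a.[k] = src b.[k] /\ u.[k] = a.[k] ** b.[k] by [].
apply: (@extend_ind (fun x y z => tgt x = src y /\ z = x ** y)) => //.
by move=> x y _ [exy ->] /=; rewrite exy fmap_acomp.
Qed.

Lemma extend_identity a k : (forall i, is_identity (a i)) -> is_identity a.[k].
Proof.
move=> ha; apply: (@extend_ind (fun x _ _ => is_identity x) a a a) => //.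
by move=> x _ _; apply: fmap_identity.
Qed.

Lemma ord_ind (P : nat -> Prop) :
  (forall i : 'I_m, P i) -> forall k, k < m -> P k.
Proof. by move=> Pi k lt_km; apply: (Pi (Ordinal lt_km)). Qed.

Lemma ord_down_ind (P : nat -> Prop) :
  P m -> (forall i : 'I_m, P i.+1 -> P i) -> forall k, k <= m -> P k.
Proof.
move=> Pm PS k; move en: (m - k) => n.
elim: n k en => [|n IH] k en le_km; first by have -> : k = m by lia.
have lt_km : k < m by lia.
by apply: (PS (Ordinal lt_km)); apply: IH => /=; lia.
Qed.

(** * Suffixes of a factorisation of [Delta] *)

Lemma seq_comp_suffixes (l : seq (arrow G)) (x z : arrow G) :
  seq_comp l z ->
  exists q : nat -> arrow G, [/\ q 0 = z, is_identity (q (size l)),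
    tgt (q (size l)) = tgt z &
    forall i, i < size l -> tgt (nth x l i) = src (q i.+1) /\
                            nth x l i ** q i.+1 = q i].
Proof.
elim=> {l z} [y|c l d e _ [q [q0 qn qt qS]] /is_compP[ecd ee]].
  by exists (fun=> aid y); split=> //; exists y.
exists (fun i => if i is j.+1 then q j else e); split=> //=.
  by rewrite qt -ee tgt_acomp.
by case=> [|i] /= lt_i; [rewrite q0 | apply: qS].
Qed.

(** [q i] is the composite of the terms of [f] of index at least [i]. *)
Lemma divided_suffixes f : exists q : nat -> arrow G,
  [/\ q 0 = aDelta (src (f i0)), q m = aid (phi (src (f i0))) &
   forall i : 'I_m, tgt (f i) = src (q i.+1) /\ f i ** q i.+1 = q i].
Proof.
have [q [q0 qn qt qS]] := seq_comp_suffixes (f i0) (dseqP f).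
move: qn qt qS; rewrite size_codom card_ord => qn qt qS.
exists q; split=> // [|i]; first by case: qn qt => x -> /= ->.
have := qS i (ltn_ord i).
by rewrite codomE (nth_map i0) ?size_enum_ord // nth_ord_enum.
Qed.

(** Cyclic composability: the last term ends where [(f i0)^phi] begins. *)
Lemma divided_tgt f k : k < m -> tgt f.[k] = src f.[k.+1].
Proof.
move: k; apply: ord_ind => i; have [q [q0 qm qS]] := divided_suffixes f.
rewrite extend_ord (qS i).1.
have := ltn_ord i; rewrite leq_eqVlt => /predU1P[e|lt].
  by rewrite e qm extend_m0.
have [_ <-] := qS (Ordinal lt).
by rewrite src_acomp -(extend_ord _ (Ordinal lt)).
Qed.

(** A suffix of [f] is a suffix of [Delta], so [asimple_suffix] applies. *)
Lemma suffix_simple f q : q 0 = aDelta (src (f i0)) ->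
  (forall i : 'I_m, tgt (f i) = src (q i.+1) /\ f i ** q i.+1 = q i) ->
  forall i, i <= m -> asimple (q i).
Proof.
move=> q0 qS; elim=> [_|i IH lt_im]; first by rewrite q0; apply: adiv_refl.
have [et e] := qS (Ordinal lt_im); apply: (asimple_suffix et).
by rewrite e; apply: IH; apply: ltnW.
Qed.

Lemma divided_simple f i : asimple (f i).
Proof.
have [q [q0 qm qS]] := divided_suffixes f.
apply: asimple_adiv (suffix_simple q0 qS (ltnW (ltn_ord i))).
by have [et e] := qS i; exists (q i.+1).
Qed.

Lemma divided_ob_ext f g : (forall i, f i = g i) -> f = g.
Proof.
case: f g => [s ps] [t pt] /= /funext e; subst t.
by rewrite (Prop_irrelevance ps pt).
Qed.

(** * Edges from factorisations *)

(** Any termwise factorisation [f_i = u_i r_i] is an edge out of [f]; what has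
    to be checked is that the target sequence [r_i u_(i+1)] composes to
    [Delta]. *)
Lemma edge_of_factors f u (r : 'I_m -> arrow G) :
  (forall i, tgt (u i) = src (r i) /\ u i ** r i = f i) ->
  exists2 g, is_divided_edge f g u & forall i : 'I_m, g i = r i ** u.[i.+1].
Proof.
move=> ur; have [q [q0 qm qS]] := divided_suffixes f.
have usrc i : src (u i) = src (f i) by have [_ <-] := ur i; rewrite src_acomp.
have rtgt i : tgt (r i) = tgt (f i).
  by have [e <-] := ur i; rewrite tgt_acomp.
have rutgt (i : 'I_m) : tgt (r i) = src u.[i.+1].
  rewrite rtgt -extend_ord divided_tgt //; apply: extend_src => j.
  by rewrite usrc.
pose h k := r.[k] ** u.[k.+1].
pose v := (u i0)^phi.
(* [q' k] is the suffix of the target at index [k]: the one with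
   [u_k q'_k = q_k (u_0)^phi]. *)
pose q' k := if k == m then aid (tgt v) else r.[k] ** (q k.+1 ** v).
have qv k : k <= m -> tgt (q k) = src v.
  move: k; apply: ord_down_ind => [|i IH]; first by rewrite qm /= usrc.
  by have [e <-] := qS i; rewrite tgt_acomp.
have q'P k : k <= m -> tgt u.[k] = src (q' k) /\ u.[k] ** q' k = q k ** v.
  rewrite /q' leq_eqVlt => /predU1P[->|].
    by rewrite eqxx qm extend_m0 -/v acompf1 // acomp1f //= usrc.
  move: k; apply: ord_ind => i.
  rewrite (ltn_eqF (ltn_ord i)) !extend_ord src_acomp.
  have [e1 e2] := ur i; have [e3 e4] := qS i; split=> //.
  rewrite acompA ?src_acomp ?rtgt // e2 acompA ?e4 //.
  exact: qv.
have hP : in_divided m_gt0 (fun k : 'I_m => h k).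
  rewrite /in_divided.
  have e0 : q' 0 = aDelta (src (h i0)).
    have [e] := q'P 0 isT; rewrite q0 extend_0 -usrc /v -aDelta_natural.
    rewrite /h src_acomp extend_ord -(ur i0).1.
    by apply: acomp_cancell; rewrite // -e extend_0.
  rewrite -[X in seq_comp _ X]e0.
  apply: (@seq_comp_suffix G m m_gt0 h q' (tgt v)); first by rewrite /q' eqxx.
  apply: ord_ind => i; apply/is_compP.
  have [e1 e2] := q'P i.+1 (ltn_ord i).
  rewrite /h extend_ord tgt_acomp //; split=> //.
  by rewrite -acompA // e2 /q' (ltn_eqF (ltn_ord i)) extend_ord.
exists (DividedOb hP) => [i|i] /=; last by rewrite /h extend_ord.
rewrite /h src_acomp extend_ord; have [e1 e2] := ur i; split=> //.
  apply/simpleP; apply: asimple_adiv (divided_simple f i).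
  by exists (r i).
by exists (r i); split; apply/is_compP.
Qed.

(** * Transformations *)

(** A natural transformation between the periodic diagrams [f] and [g]. *)
Definition is_trans f g a : Prop := forall i : 'I_m,
  [/\ src (a i) = src (f i), tgt (a i) = src (g i) &
      f i ** a.[i.+1] = a i ** g i].

Lemma edge_factor f g (s : divided_edge f g) i : exists r,
  [/\ tgt (s i) = src r, s i ** r = f i, tgt r = src s.[i.+1] &
      r ** s.[i.+1] = g i].
Proof.
have [_ _ _ [r [/is_compP[e1 e2] /is_compP[e3 e4]]]] := eseqP s i.
by exists r.
Qed.

Lemma edge_trans f g (s : divided_edge f g) : is_trans f g s.
Proof.
move=> i; have [_ es et _] := eseqP s i; split=> //.
have [r [e1 <- e2 <-]] := edge_factor s i.
by rewrite acompA.
Qed.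

Lemma trans_tgt f g a i : is_trans f g a -> tgt (f i) = src a.[i.+1].
Proof.
move=> fa; rewrite -extend_ord divided_tgt //; apply/esym/extend_src => j.
by have [] := fa j.
Qed.

Lemma trans_id f : is_trans f f (fun i => aid (src (f i))).
Proof.
move=> i; split=> //; rewrite [RHS]acomp1f //.
have [x e] : is_identity (fun i => aid (src (f i))).[i.+1].
  by apply: extend_identity => j; exists (src (f j)).
rewrite e acompf1 // -extend_ord divided_tgt //.
by have := @extend_src (fun i => aid (src (f i))) f i.+1; rewrite e => /= ->.
Qed.

Lemma trans_comp f g h a b : is_trans f g a -> is_trans g h b ->
  is_trans f h (fun i => a i ** b i).
Proof.
move=> fa gb.
have ab i : tgt (a i) = src (b i).
  by have [_ -> _] := fa i; have [-> _ _] := gb i.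
move=> i; have [a1 a2 a3] := fa i; have [b1 b2 b3] := gb i.
rewrite src_acomp tgt_acomp // extend_acomp //; split=> //.
have ea := trans_tgt i fa; have eb := trans_tgt i gb.
rewrite acompA // ?a3; last exact: extend_tgt.
by rewrite -acompA // b3 acompA.
Qed.

Fixpoint pcomps f g (p : path f g) : 'I_m -> arrow G :=
  match p with
  | PNil f => fun i => aid (src (f i))
  | PCons _ _ _ s p' => fun i => s i ** pcomps p' i
  end.

Lemma pcomps_trans f g (p : path f g) : is_trans f g (pcomps p).
Proof.
elim: p => /= [h|f' g' h s p IH]; first exact: trans_id.
exact: trans_comp (edge_trans s) IH.
Qed.

Lemma pcomps_cat f g h (p : path f g) (q : path g h) i :
  pcomps (pcat p q) i = pcomps p i ** pcomps q i.
Proof.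
elim: p q => /= [f' q|f' g' h' s p IH q].
  by rewrite acomp1f //; have [-> _ _] := pcomps_trans q i.
have [e1 e2 _] := pcomps_trans p i; have [e3 _ _] := pcomps_trans q i.
have [_ e4 _] := edge_trans s i.
by rewrite IH acompA ?e1 ?e2 ?e3.
Qed.

Lemma pcomps_edge f g (s : divided_edge f g) i : pcomps (pedge s) i = s i.
Proof. by rewrite /= acompf1 //; have [] := edge_trans s i. Qed.

Lemma pcomps_cong f g (p q : path f g) :
  pcong (@germ_rel G m m_gt0) p q -> pcomps p = pcomps q.
Proof.
elim=> {f g p q} [f g p q|||f g p q r _ -> _ ->|
    f g h p p' q q' _ IH1 _ IH2] //.
- case=> {f g p q} [f g h s t u e|f s e]; apply: funext => i.
    rewrite pcomps_cat !pcomps_edge.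
    by have /is_compP[] := e i.
  rewrite pcomps_edge /=; have /is_identityP -> := e i.
  by have [-> _ _] := edge_trans s i.
- by apply: funext => i; rewrite !pcomps_cat IH1 IH2.
Qed.

(** * Decomposing a transformation into edges *)

(** Homogeneity makes this decrease when a nontrivial edge is split off. *)
Definition total_len a := \sum_(i < m) alen (a i).

Lemma total_len_eq0 a : total_len a = 0 <-> forall i, is_identity (a i).
Proof.
split=> [/eqP|ha].
  rewrite sum_nat_eq0 => /forallP h i; apply/alen0/eqP.
  exact: (implyP (h i)).
by apply/eqP; rewrite sum_nat_eq0; apply/forallP => i; apply/implyP => _;
  apply/eqP/alen0.
Qed.

Lemma total_len_acomp a b : (forall i, tgt (a i) = src (b i)) ->
  total_len (fun i => a i ** b i) = total_len a + total_len b.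
Proof.
move=> ab; rewrite /total_len -big_split.
by apply: eq_bigr => i _; apply: alenM.
Qed.

Lemma identity_edge f g (s : divided_edge f g) :
  (forall i, is_identity (s i)) -> f = g.
Proof.
move=> hs; apply: divided_ob_ext => i.
have [r [e1 <- e2 <-]] := edge_factor s i.
have /is_identityP -> := hs i; rewrite acomp1f -?(tgt_identity (hs i)) //.
have [x e] := extend_identity i.+1 hs; move: e2.
by rewrite e => /= e2; rewrite acompf1.
Qed.

(** An edge that divides a transformation on the left leaves a transformation:
    the commutation with [h] follows by cancelling [s i]. *)
Lemma trans_cancel f g h a b (s : divided_edge f h) :
  is_trans f g a -> (forall i, tgt (s i) = src (b i) /\ s i ** b i = a i) ->
  is_trans h g b.
Proof.
move=> fa sb i; have [a1 a2 a3] := fa i; have [s1 s2] := sb i.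
have [_ s3 _] := edge_trans s i.
have tb : tgt (b i) = src (g i) by rewrite -a2 -s2 tgt_acomp.
have [r [r1 r2 r3 <-]] := edge_factor s i.
have eb : tgt s.[i.+1] = src b.[i.+1].
  by apply: extend_tgt => j; have [] := sb j.
have ea : a.[i.+1] = s.[i.+1] ** b.[i.+1].
  rewrite -extend_acomp => [|j]; last by have [] := sb j.
  by congr extend; apply: funext => j; have [] := sb j.
split; rewrite -?s1 ?src_acomp //.
apply: (@acomp_cancell _ (s i)); rewrite ?src_acomp //.

rewrite [RHS]acompA // s2 -a3 -r2 ea.
by rewrite -(acompA r3 eb) acompA ?src_acomp.
Qed.

Lemma quotients u a : (forall i, adiv (u i) (a i)) ->
  exists b, forall i, tgt (u i) = src (b i) /\ u i ** b i = a i.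
Proof.
move=> ua; suff: forall i, exists c, tgt (u i) = src c /\ u i ** c = a i.
  exact: fin_all_exists.
by move=> i; have [c] := ua i; exists c.
Qed.

Lemma trans_split f g a u : is_trans f g a ->
  (forall i, adiv (u i) (a i)) -> (forall i, adiv (u i) (f i)) ->
  exists h (s : divided_edge f h) b,
    [/\ forall i, s i = u i, is_trans h g b &
        forall i, tgt (s i) = src (b i) /\ s i ** b i = a i].
Proof.
move=> fa ua uf.
have [b hb] := quotients ua; have [r hr] := quotients uf.
have [h hs _] := edge_of_factors hr; exists h, (DividedEdge hs), b; split=> //.
exact: (trans_cancel (s := DividedEdge hs) fa).
Qed.

(** If [a] is coprime to [f] in each component, a nontrivial simple divisor of
    [a_1] propagates to nontrivial common divisors of [a_k] and of the suffix
    [f_k ... f_m]; this is absurd when the suffix is empty.  So [a_1] is an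
    identity, and then so is [a_(m+1)]; going down, [a_i] divides
    [a_i g_i = f_i], and is an identity as well. *)
Lemma coprime_trans f g a : is_trans f g a ->
  (forall i d, adiv d (a i) -> adiv d (f i) -> is_identity d) ->
  forall i, is_identity (a i).
Proof.
move=> fa cop; have [q [q0 qm qS]] := divided_suffixes f.
have step1 : is_identity (a i0).
  apply: contrapT => /simple_prefix [c [nc sc ca]].
  have : forall k, k <= m ->
      exists d, [/\ ~ is_identity d, adiv d a.[k] & adiv d (q k)].
    elim=> [_|k IH lt_km].
      exists c; rewrite extend_0 q0; split=> //.
      by have [<- _ _] := fa i0; rewrite -(adiv_src ca).
    have [d [nd da dq]] := IH (ltnW lt_km).
    pose i := Ordinal lt_km; move: da; rewrite (extend_ord _ i) => da.
    have [a1 a2 a3] := fa i; have [q1 q2] := qS i.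
    have [|j [dj fj jmin]] := @alcm_ex G d (f i).
      by rewrite (adiv_src da).
    (* The lcm of [d] and [f_k] divides both [q_k = f_k q_(k+1)] and
       [a_k g_k = f_k a_(k+1)]: cancel [f_k]. *)
    have [d' fd' ej] := fj; exists d'; split.
    - move=> d'1; apply: nd; apply: (cop i) => //.
      move: dj; rewrite -ej; move: fd'.
      by case: d'1 => x -> /= e; rewrite acompf1.
    - apply: (adiv_cancel fd' (trans_tgt i fa)); rewrite ej; apply: jmin.
        by rewrite a3; apply: adiv_mulr.
      by apply: adiv_mulr; [apply: trans_tgt fa | apply: adiv_refl].
    - apply: (adiv_cancel fd' q1); rewrite ej q2; apply: jmin => //.
      by exists (q i.+1).
  case/(_ m (leqnn m)) => d [nd _]; rewrite qm => /alen_adiv.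
  by rewrite alen_aid leqn0 => /eqP/alen0.
suff H k : k <= m -> is_identity a.[k].
  by move=> i; rewrite -extend_ord; apply: H; apply: ltnW.
move: k; apply: ord_down_ind => [|i ida].
  by rewrite extend_m0; apply: fmap_identity.
have [a1 a2 a3] := fa i.
rewrite extend_ord; apply: (cop i); first exact: adiv_refl.
exists (g i) => //; rewrite -a3; have := trans_tgt i fa.
by case: ida => x -> /= e; rewrite acompf1.
Qed.

(** The termwise gcd of [a] and [f] is an edge, like every termwise divisor of
    [f]. *)
Lemma greedy_edge f g a : is_trans f g a ->
  exists h (s : divided_edge f h) b,
    [/\ is_trans h g b, forall i, tgt (s i) = src (b i) /\ s i ** b i = a i &
        forall i d, adiv d (a i) -> adiv d (f i) -> adiv d (s i)].
Proof.
move=> fa.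
have gcd_af i : exists c, [/\ adiv c (a i), adiv c (f i) &
    forall d, adiv d (a i) -> adiv d (f i) -> adiv d c].
  by apply: agcd_ex; have [] := fa i.
have [u hu] := fin_all_exists gcd_af.
have [||h [s [b [su hb sb]]]] := trans_split (u := u) fa.
- by move=> i; have [] := hu i.
- by move=> i; have [] := hu i.
by exists h, s, b; split=> // i; rewrite su; have [] := hu i.
Qed.

(** The greatest edge dividing a nontrivial transformation is nontrivial, which
    is what makes the inductions progress. *)
Lemma greedy_neq0 f g h a (s : divided_edge f h) : is_trans f g a ->
  (forall i d, adiv d (a i) -> adiv d (f i) -> adiv d (s i)) ->
  total_len s = 0 -> total_len a = 0.
Proof.
move=> fa smax /total_len_eq0 hs; apply/total_len_eq0.
apply: (coprime_trans fa) => i d da df.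
have := alen_adiv (smax i d da df).
by have /alen0 -> := hs i; rewrite leqn0 => /eqP/alen0.
Qed.

Lemma trans_identity f g a : is_trans f g a -> total_len a = 0 -> f = g.
Proof.
move=> fa /total_len_eq0 ha; apply: divided_ob_ext => i.
have [a1 a2] := fa i; have := trans_tgt i fa.
case: (extend_identity i.+1 ha) => x -> /= e; rewrite acompf1 // => ->.
by move: a2; case: (ha i) => y -> /= ?; rewrite acomp1f.
Qed.

(** Fullness: splitting off greatest edges must terminate. *)
Lemma trans_path f g a : is_trans f g a -> exists p : path f g, pcomps p = a.
Proof.
have [n] := ubnP (total_len a); elim: n f g a => // n IH f g a lta fa.
have [mu0|mu_neq0] := eqVneq (total_len a) 0.
  have e := trans_identity fa mu0; subst g; exists (PNil f) => /=.
  apply: funext => i; have [<- _ _] := fa i.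
  by have /total_len_eq0/(_ i)/is_identityP := mu0.
have [h [s [b [hb sb smax]]]] := greedy_edge fa.
have ea : a = fun i => s i ** b i by apply: funext => i; have [] := sb i.
have sb' i : tgt (s i) = src (b i) by have [] := sb i.
have [|p ep] := IH h g b _ hb; last by exists (PCons s p); rewrite /= ep.
have : total_len s <> 0.
  by move/(greedy_neq0 fa smax) => e; rewrite e in mu_neq0.
by move: lta; rewrite ea total_len_acomp // ltnS; lia.
Qed.

(** * Paths with the same components are congruent *)

Local Notation "p =~ q" := (pcong (@germ_rel G m m_gt0) p q) (at level 70).

Lemma pcomps_src f g h (s : divided_edge f g) (p : path g h) i :
  tgt (s i) = src (pcomps p i).
Proof.
by have [_ -> _] := edge_trans s i; have [-> _ _] := pcomps_trans p i.
Qed.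

Lemma pcons_cong f g h (s : divided_edge f g) (p q : path g h) :
  pcong (@germ_rel G m m_gt0) p q ->
  pcong (@germ_rel G m m_gt0) (PCons s p) (PCons s q).
Proof. by move=> pq; apply: (PCat (PRefl _ (pedge s)) pq). Qed.

Lemma pcons_identity f g (s : divided_edge f f) (p : path f g) :
  (forall i, is_identity (s i)) -> pcong (@germ_rel G m m_gt0) (PCons s p) p.
Proof. by move=> hs; apply: (PCat (PRel (GermId hs)) (PRefl _ p)). Qed.

(** Equality of arrows of the divided category avoids transporting [p] along
    [f = g]. *)
Lemma trivial_path f g (p : path f g) : total_len (pcomps p) = 0 ->
  Arrow (pclass_of (@germ_rel G m m_gt0) p : @hom Cm f g) = aid (f : Cm).
Proof.
elim: p => {f g} // f g h s p IH /=.
rewrite total_len_acomp => [/eqP|i]; last exact: pcomps_src.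
rewrite addn_eq0 => /andP[/eqP/total_len_eq0 hs /eqP/IH].
have e := identity_edge hs; subst g => <-; congr Arrow.
exact/Defs.piP/pcons_identity.
Qed.

Lemma pcong_identity f (p : path f f) : total_len (pcomps p) = 0 -> p =~ PNil f.
Proof. by move/trivial_path/arrow_inj/Defs.piP. Qed.

(** With [s_i r'_i = f_i], the termwise quotient [w] of [s] by [t] divides [g]:
    [g_i = w_i (r'_i t_(i+1))]. *)
Lemma edge_quotient f g h (t : divided_edge f g) (s : divided_edge f h) :
  (forall i, adiv (t i) (s i)) ->
  exists w : divided_edge g h, forall i,
    tgt (t i) = src (w i) /\ t i ** w i = s i.
Proof.
move=> ts; have [w hw] := quotients ts.
suff hgh : is_divided_edge g h w by exists (DividedEdge hgh).
move=> i; have [w1 w2] := hw i.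
have [_ t1 _] := edge_trans t i; have [_ s1 _] := edge_trans s i.
have [r [r1 r2 r3 r4]] := edge_factor t i.
have [r' [r1' r2' r3' r4']] := edge_factor s i.
have wt : tgt (w i) = tgt (s i) by rewrite -w2 tgt_acomp.
have tsrc : tgt t.[i.+1] = src w.[i.+1].
  by apply: extend_tgt => j; have [] := hw j.
have est : s.[i.+1] = t.[i.+1] ** w.[i.+1].
  rewrite -extend_acomp => [|j]; last by have [] := hw j.
  by congr extend; apply: funext => j; have [] := hw j.
have r't : tgt r' = src t.[i.+1] by rewrite r3' est src_acomp.
have er : r = w i ** r'.
  by apply: (@acomp_cancell _ (t i)); rewrite ?src_acomp // r2 acompA ?w2 ?wt.
have eg : w i ** (r' ** t.[i.+1]) = g i by rewrite acompA ?wt // -er.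
split; rewrite -?t1 ?wt //.
  apply/simpleP; apply: asimple_adiv (divided_simple g i).
  by exists (r' ** t.[i.+1]); rewrite // src_acomp wt.
exists (r' ** t.[i.+1]); split; apply/is_compP; rewrite ?src_acomp ?wt //.
by rewrite tgt_acomp // -acompA // -est.
Qed.

(** The induction step of faithfulness: a path is congruent to any path with the
    same components that begins with a greatest edge [s].  A first edge [t]
    that is an identity is dropped; otherwise [t] divides [s], and [t] followed
    by the quotient edge is [s] by a germ relation, while faithfulness for
    smaller total length applies after [t]. *)
Lemma greedy_cong n :
  (forall f g (p q : path f g),
     total_len (pcomps p) < n -> pcomps p = pcomps q -> p =~ q) ->
  forall f g (p : path f g) h (s : divided_edge f h) (q : path h g),
    total_len (pcomps p) <= n ->
    (forall i d, adiv d (pcomps p i) -> adiv d (f i) -> adiv d (s i)) ->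
    total_len s <> 0 -> pcomps p = pcomps (PCons s q) -> p =~ PCons s q.
Proof.
move=> faithful f g; elim=> {f g} [f|f f1 g t p IH] h s q lep smax mus epq.
  have : total_len (pcomps (PNil f)) = 0.
    by apply/total_len_eq0 => i; exists (src (f i)).
  by rewrite epq /= total_len_acomp; [lia | apply: pcomps_src].
have [mut|mut] := eqVneq (total_len t) 0.
  have ht := total_len_eq0 t; case: ht => /(_ mut) ht _.
  have e := identity_edge ht; subst f1.
  apply: (PTrans (pcons_identity _ ht)).
  have ep : pcomps p = pcomps (PCons t p).
    apply: funext => i /=; have := pcomps_src t p i.
    by case: (ht i) => x -> /= e; rewrite acomp1f.
  by apply: IH; rewrite // ep.
have [w hw] : exists w : divided_edge f1 h,
    forall i, tgt (t i) = src (w i) /\ t i ** w i = s i.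
  apply: edge_quotient => i; apply: smax => /=.
    by exists (pcomps p i) => //; apply: pcomps_src.
  by have [r [r1 r2 _ _]] := edge_factor t i; exists r.
have pw : p =~ PCons w q.
  apply: faithful.
    by move: lep; rewrite /= total_len_acomp; [lia | apply: pcomps_src].
  apply: funext => i /=; have [w1 w2] := hw i.
  apply: (@acomp_cancell _ (t i)).
  - exact: pcomps_src.
  - by rewrite src_acomp.
  - by rewrite acompA ?w2 //; [have := congr1 (@^~ i) epq | apply: pcomps_src].
apply: (PTrans (pcons_cong t pw)).
have tws : pcat (pedge t) (pedge w) =~ pedge s.
  by apply: PRel; apply: GermComp => i; apply/is_compP.
exact: (PCat tws (PRefl _ q)).
Qed.

(** Faithfulness: two paths with the same components share the greatest edge, so
    both are congruent to one path beginning with it. *)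
Lemma pcomps_inj f g (p q : path f g) : pcomps p = pcomps q -> p =~ q.
Proof.
have [n] := ubnP (total_len (pcomps p)).
elim: n f g p q => // n IH f g p q ltp epq.
have [mu0|mu_neq0] := eqVneq (total_len (pcomps p)) 0.
  have e := trans_identity (pcomps_trans p) mu0; subst g.
  apply: (PTrans (pcong_identity mu0)); apply: PSym.
  by apply: pcong_identity; rewrite -epq.
have [h [s [b [hb sb smax]]]] := greedy_edge (pcomps_trans p).
have [v ev] := trans_path hb.
have ep : pcomps p = pcomps (PCons s v).
  by apply: funext => i /=; rewrite ev; have [] := sb i.
have mus : total_len s <> 0.
  by move/(greedy_neq0 (pcomps_trans p) smax) => e; rewrite e in mu_neq0.
have ps := greedy_cong IH ltp smax mus ep.
rewrite epq in smax ep ltp; have qs := greedy_cong IH ltp smax mus ep.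
exact: (PTrans ps (PSym qs)).
Qed.

(** * Morphisms of the divided category are transformations *)

Definition comps f g (c : @hom Cm f g) : 'I_m -> arrow G := pcomps (prepr c).

Lemma comps_pi f g (p : path f g) :
  comps (pclass_of (@germ_rel G m m_gt0) p) = pcomps p.
Proof. exact/pcomps_cong/repr_pi. Qed.

Lemma comps_trans f g (c : @hom Cm f g) : is_trans f g (comps c).
Proof. exact: pcomps_trans. Qed.

Lemma comps_inj f g (c d : @hom Cm f g) : comps c = comps d -> c = d.
Proof.
by rewrite -(preprK c) -(preprK d) !comps_pi => /pcomps_inj/Defs.piP.
Qed.

Lemma comps_id f i : comps (idm (f : Cm)) i = aid (src (f i)).
Proof. by rewrite comps_pi. Qed.

Lemma comps_comp f g h (c : @hom Cm f g) (d : @hom Cm g h) i :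
  comps (c ;; d) i = comps c i ** comps d i.
Proof. by rewrite comps_pi pcomps_cat. Qed.

(** The form of [comps_inj] for morphisms whose endpoints are only
    propositionally equal, as in [extends_theta]. *)
Lemma arrow_comps_inj (b c : arrow Cm) : src b = src c -> tgt b = tgt c ->
  comps (amor b) = comps (amor c) -> b = c.
Proof.
case: b c => [f g c] [f' g' d] /= e1 e2; subst f' g' => e.
by congr Arrow; apply: comps_inj.
Qed.

Definition trans_mor f g a (fa : is_trans f g a) : @hom Cm f g :=
  pclass_of (@germ_rel G m m_gt0) (projT1 (cid (trans_path fa))).

Lemma comps_trans_mor f g a (fa : is_trans f g a) : comps (trans_mor fa) = a.
Proof. by rewrite comps_pi; case: cid. Qed.

(** * The functor [Theta] *)

Lemma const_trans (x y : G) (s : hom x y) :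
  is_trans (theta_ob m_gt0 x) (theta_ob m_gt0 y) (fun=> Arrow s).
Proof.
move=> i; rewrite /= /theta_seq; have [e|ne] := eqVneq i.+1 m.
  split=> //; rewrite [X in extend _ _ X]e extend_m0.
  by rewrite -(aDelta_natural (Arrow s)).
have lt_im : i.+1 < m by rewrite ltn_neqAle ne ltn_ord.
split=> //; rewrite (extend_ord _ (Ordinal lt_im)).
by rewrite [LHS]acomp1f // [RHS]acompf1.
Qed.

Definition Theta_map (x y : G) (s : hom x y) :
  @hom Cm (theta_ob m_gt0 x) (theta_ob m_gt0 y) := trans_mor (const_trans s).

Lemma src_theta_ob (x : G) (i : 'I_m) : src (theta_ob m_gt0 x i) = x.
Proof. by rewrite /= /theta_seq; case: ifP. Qed.

Lemma Theta_map1 (x : G) : Theta_map (idm x) = idm (theta_ob m_gt0 x : Cm).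
Proof.
apply: comps_inj; apply: funext => i.
by rewrite comps_trans_mor comps_id src_theta_ob.
Qed.

Lemma Theta_mapM (x y z : G) (s : hom x y) (t : hom y z) :
  Theta_map (s ;; t) = Theta_map s ;; Theta_map t.
Proof.
apply: comps_inj; apply: funext => i.
by rewrite comps_comp !comps_trans_mor acompE.
Qed.

Definition Theta : functor G Cm := Functor Theta_map1 Theta_mapM.

Lemma comps_Theta (x y : G) (s : hom x y) :
  comps (fmap Theta s) = fun=> Arrow s.
Proof. exact: comps_trans_mor. Qed.

(** Each component receives [s] from exactly one edge, the last one first. *)
Lemma pcomps_theta_path (x y : G) (s : hom x y) sbar
    (e : s ;; sbar = gDelta x) j (le_jm : j <= m) (i : 'I_m) :
  pcomps (theta_path m_gt0 e le_jm) i =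
  if i.+1 <= m - j then aid x else Arrow s.
Proof.
elim: j le_jm => [|j IH] le_jm.
  rewrite subn0 ltn_ord /=.
  case: _ / (bool_irrelevance (leq0n m) le_jm) => /=.
  by rewrite theta_step_seq0 // (src_theta_ob x i).
transitivity (pcomps (pcat (theta_path m_gt0 e (ltnW le_jm))
                           (pedge (theta_edge m_gt0 e le_jm))) i) => //.
rewrite pcomps_cat pcomps_edge IH /= /theta_edge_seq.
have [lt|gt|eq] := ltngtP i.+1 (m - j).
- by rewrite ifT; [exact: acomp1f | lia].
- by rewrite ifF; [exact: acompf1 | lia].
- by rewrite ifF; [exact: acomp1f | lia].
Qed.

Lemma Theta_extends : extends_theta Theta.
Proof.
split=> // x y s sbar e; apply: arrow_comps_inj => /=.
- by rewrite theta_step0.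
- by rewrite theta_stepm.
rewrite comps_Theta comps_pi; apply: funext => i.
by rewrite pcomps_theta_path subnn.
Qed.

Lemma Theta_unique (F : functor G Cm) : extends_theta F -> F = Theta.
Proof.
move=> [Fo Fs]; apply: functor_ext => // x y f.
suff H (a : arrow G) : fmap_arrow F a = fmap_arrow Theta a.
  exact: (H (Arrow f)).
elim/simple_ind: a => [z|[z t s] /simpleP[sbar e]|a b ab IHa IHb].
- by rewrite !fmap_aid Fo.
- by rewrite /fmap_arrow /= (Fs _ _ _ _ e); have [_ <-] := Theta_extends.
- by rewrite !fmap_acomp // IHa IHb.
Qed.

(** * The first component *)

Definition first_map f g (c : @hom Cm f g) : hom (src (f i0)) (src (g i0)) :=
  let: And3 ex ey _ := comps_trans c i0 in hom_of ex ey.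

Lemma first_mapE f g (c : @hom Cm f g) : Arrow (first_map c) = comps c i0.
Proof. by rewrite /first_map; case: comps_trans => ? ? _; apply: hom_ofK. Qed.

Lemma first_map1 f : first_map (idm (f : Cm)) = idm (src (f i0)).
Proof. by apply: arrow_inj; rewrite first_mapE comps_id. Qed.

Lemma first_mapM f g h (c : @hom Cm f g) (d : @hom Cm g h) :
  first_map (c ;; d) = first_map c ;; first_map d.
Proof. by apply: arrow_inj; rewrite -acompE !first_mapE comps_comp. Qed.

Definition first_functor : functor Cm G :=
  @Functor Cm G (fun f => src (f i0)) first_map first_map1 first_mapM.

Fixpoint prefix_comp f k : arrow G :=
  if k is k'.+1 then prefix_comp f k' ** f.[k'] else aid (src (f i0)).

Lemma prefix_ends f k : k <= m ->
  src (prefix_comp f k) = src (f i0) /\ tgt (prefix_comp f k) = src f.[k].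
Proof.
elim: k => [_|k IH lt_km] /=; first by rewrite extend_0.
by have [e1 e2] := IH (ltnW lt_km); rewrite src_acomp tgt_acomp ?divided_tgt.
Qed.

Lemma prefix_total f : prefix_comp f m = aDelta (src (f i0)).
Proof.
have [q [q0 qm qS]] := divided_suffixes f.
suff H k : k <= m ->
    tgt (prefix_comp f k) = src (q k) /\ prefix_comp f k ** q k = q 0.
  by have [e] := H m (leqnn m); rewrite q0 => <-; rewrite qm acompf1 // e qm.
elim: k => [_|k IH lt_km]; first by rewrite /= acomp1f // q0.
have [e1 e2] := IH (ltnW lt_km); have [e3 e4] := qS (Ordinal lt_km).
have [_ e5] := prefix_ends f (ltnW lt_km).
rewrite /= (extend_ord _ (Ordinal lt_km)).
rewrite (extend_ord _ (Ordinal lt_km)) in e5.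
by rewrite tgt_acomp //; split=> //; rewrite -acompA // e4.
Qed.

Lemma prefix_trans f :
  is_trans (theta_ob m_gt0 (src (f i0))) f (fun i => prefix_comp f i).
Proof.
move=> i; have [e1 e2] := prefix_ends f (ltnW (ltn_ord i)).
rewrite src_theta_ob e1 e2 extend_ord; split=> //.
rewrite /= /theta_seq; have [e|ne] := eqVneq i.+1 m.
  rewrite [X in extend _ _ X]e extend_m0 /= fmap_aid acompf1 //.
  rewrite -[LHS]/(aDelta (src (f i0))) -prefix_total.
  by rewrite -[X in prefix_comp f X]e /= extend_ord.
have lt_im : i.+1 < m by rewrite ltn_neqAle ne ltn_ord.
rewrite (extend_ord _ (Ordinal lt_im)) [LHS]acomp1f /=.
  by rewrite extend_ord.
by rewrite src_acomp e1.
Qed.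

(** The counit of a coreflection: it spreads the objects of the diagram, all
    equal to [x_1] at first, out to their positions in [f]. *)
Definition gather f : @hom Cm (Theta (first_functor f)) f :=
  trans_mor (prefix_trans f).

Lemma gather_natural f g (c : @hom Cm f g) :
  fmap Theta (fmap first_functor c) ;; gather g = gather f ;; c.
Proof.
apply: comps_inj; apply: funext => i.
rewrite !comps_comp comps_Theta !comps_trans_mor [Arrow _]first_mapE.
have ct := comps_trans c.
suff: forall k, k <= m ->
    comps c i0 ** prefix_comp g k = prefix_comp f k ** (comps c).[k].
  by move=> ->; rewrite ?extend_ord // ltnW.
elim=> [_|k IH lt_km] /=.
  by have [e1 e2 _] := ct i0; rewrite extend_0 acompf1 // acomp1f.
have [_ e1] := prefix_ends f (ltnW lt_km).
have [e2 e3] := prefix_ends g (ltnW lt_km).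
have := trans_tgt (Ordinal lt_km) ct.
have [] := ct (Ordinal lt_km); rewrite -!(extend_ord _ (Ordinal lt_km)) /=.
move=> c1 c2 c3 c4.
have [_ c5 _] := ct i0.
rewrite acompA ?e2 // IH 1?ltnW // -acompA ?c1 // -c3.
by rewrite acompA // e1.
Qed.

End DividedMorphisms.

(** * Groupoids of fractions *)

Section Fractions.
Variable C : category.
Local Notation Fr := (groupoid_of_fractions C).

Definition frac (x y : C) (p : gpath (@zigzag C) x y) : @hom Fr x y :=
  pclass_of (@fraction_rel C) p.

Definition frac_inv (x y : C) (f : hom x y) : @hom Fr y x :=
  frac (pedge (inr f : zigzag y x)).

Lemma fracK (x y : C) (f : hom x y) :
  fmap (to_fractions C) f ;; frac_inv f = idm (x : Fr).
Proof. by rewrite /= pcomp_pi; apply/Defs.piP/PRel; constructor. Qed.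

Lemma frac_invK (x y : C) (f : hom x y) :
  frac_inv f ;; fmap (to_fractions C) f = idm (y : Fr).
Proof. by rewrite /= pcomp_pi; apply/Defs.piP/PRel; constructor. Qed.

Lemma to_fractions_iso (x y : C) (f : hom x y) :
  is_iso (fmap (to_fractions C) f).
Proof. by exists (frac_inv f); rewrite fracK frac_invK. Qed.

(** Naturality along [f] gives naturality along the formal inverse of [f]. *)
Lemma fractions_natural (D : category) (P Q : functor Fr D)
    (eta : forall x : C, hom (P x) (Q x)) :
  (forall (x y : C) (f : @hom C x y),
     fmap P (fmap (to_fractions C) f) ;; eta y =
     eta x ;; fmap Q (fmap (to_fractions C) f)) ->
  @natural Fr D P Q eta.
Proof.
move=> nat_eta.
suff nat_path (x y : C) (p : gpath (@zigzag C) x y) :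
    fmap P (frac p) ;; eta y = eta x ;; fmap Q (frac p).
  by move=> x y c; rewrite -(preprK c); apply: nat_path.
elim: p => {x y} [x|x y z e p IH].
  by rewrite (fmap1 P (x : Fr)) (fmap1 Q (x : Fr)) Defs.comp1f Defs.compf1.
have -> : frac (PCons e p) = frac (pedge e) ;; frac p by rewrite /= pcomp_pi.
rewrite !fmapM -Defs.compA IH !Defs.compA; congr (_ ;; _).
case: e => f; first exact: nat_eta.
rewrite -/(frac_inv f) -[LHS]Defs.compf1 -(fmap1 Q) -(fracK f) fmapM Defs.compA.
rewrite -(Defs.compA _ (eta y)) -nat_eta Defs.compA -fmapM frac_invK.
by rewrite fmap1 Defs.comp1f.
Qed.

End Fractions.

Lemma comp_inducedE (C D E : category) (F : functor C D) (H : functor D E)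
    (x y : C) (f : hom x y) :
  fmap (comp_functor (induced_functor F) (induced_functor H))
       (fmap (to_fractions C) f) =
  fmap (to_fractions E) (fmap H (fmap F f)).
Proof.
transitivity (fmap (induced_functor H)
  (fmap (induced_functor F) (fmap (to_fractions C) f))) => //.
by rewrite !induced_functorE.
Qed.

(** * The equivalence *)

Section Equivalence.
Variables (G : garside) (m : nat) (m_gt0 : 0 < m).
Local Notation Cm := (divided_category G m_gt0).
Local Notation Theta := (@Theta G m m_gt0).
Local Notation first_functor := (@first_functor G m m_gt0).

(** [first_functor (Theta x)] is only propositionally equal to [x]. *)
Definition first_theta (x : G) : hom (first_functor (Theta x)) x :=
  hom_of (a := aid x) (esym (src_theta_ob m_gt0 x (ord_first m_gt0))) erefl.

Lemma first_theta_natural (x y : G) (f : hom x y) :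
  fmap first_functor (fmap Theta f) ;; first_theta y = first_theta x ;; f.
Proof.
apply: arrow_inj; rewrite -!acompE !hom_ofK [Arrow _]first_mapE comps_Theta.
by rewrite acompf1 // acomp1f.
Qed.

Lemma Theta_equivalence : is_equivalence (induced_functor Theta).
Proof.
exists (induced_functor first_functor); split.
  exists (fun x => fmap (to_fractions G) (first_theta x)); split=> [|x].
    apply: fractions_natural => x y f.
    have e := congr1 (fmap (to_fractions G)) (first_theta_natural f).
    by move: e; rewrite !fmapM comp_inducedE.
  exact: to_fractions_iso.
exists (fun f => fmap (to_fractions Cm) (gather f)); split=> [|f].
  apply: fractions_natural => f g c.
  have e := congr1 (fmap (to_fractions Cm)) (gather_natural c).
  by move: e; rewrite !fmapM comp_inducedE.
exact: to_fractions_iso.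
Qed.

End Equivalence.

Theorem theorem9p5 (G : garside) (m : nat) (m_gt0 : 0 < m) :
  exists Theta : functor G (divided_category G m_gt0),
    [/\ extends_theta Theta,
        forall F : functor G (divided_category G m_gt0),
          extends_theta F -> F = Theta
      & is_equivalence (induced_functor Theta)].
Proof.
exists (@Theta G m m_gt0); split.
- exact: Theta_extends.
- exact: Theta_unique.
- exact: Theta_equivalence.
Qed.
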